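(* Let $Y^= \subseteq\mathbb{E}_p$ be the outcome set of a multiobjective linear program with $p$ objectives, let $Y^\leq=\{\mathbf z\in\mathbb{E}_p : \mathbf z\le\mathbf y \text{ for some } \mathbf y\in Y^=\}$, and let $T^\leq\subseteq\mathbb{T}_p$ be the associated projective polytope. Then the visible Euclidean vertices of $T^\leq$ are precisely the efficient extreme outcomes of the multiobjective linear program. That is, the only vertices of $T^\leq$ that are not efficient extreme outcomes are the $p$ vertices at infinity $(-1,0,\ldots,0,0),(0,-1,\ldots,0,0),\ldots,(0,0,\ldots,-1,0)$.
   Context: $\mathbb{E}_d$ denotes $d$-dimensional Euclidean space; vector inequalities are componentwise; a polyhedron is an intersection of finitely many closed half-spaces, and a polytope is a bounded polyhedron. Multiobjective linear program: given an $m\times n$ real matrix $A$, $\mathbf b\in\mathbb{R}^m$ and a $p\times n$ real objective matrix $C$, the feasible set $X=\{\mathbf x\in\mathbb{E}_n : A\mathbf x=\mathbf b,\ \mathbf x\ge\mathbf 0\}$ is assumed to be bounded, and the outcome set is the polytope $Y^==\{C\mathbf x:\mathbf x\in X\}\subseteq\mathbb{E}_p$. A point $\mathbf y\in Y^=$ is efficient if there is no other $\mathbf y'\in Y^=$, $\mathbf y'\neq\mathbf y$, with $\mathbf y'\ge\mathbf y$; the efficient extreme outcomes are the vertices of $Y^=$ that are efficient. The set $Y^\leq$ is an (unbounded) polyhedron. Oriented projective space $\mathbb{T}_p$: its points are the nonzero vectors of $\mathbb{R}^{p+1}$ (signed homogeneous coordinates), where two vectors represent the same point if and only if each is a positive scalar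 multiple of the other. A point $(x_1,\ldots,x_{p+1})$ is visible if $x_{p+1}>0$ (and is identified with the Euclidean point $(x_1/x_{p+1},\ldots,x_p/x_{p+1})\in\mathbb{E}_p$), invisible if $x_{p+1}<0$, and a point at infinity if $x_{p+1}=0$. A nonzero $\mathbf h\in\mathbb{R}^{p+1}$ defines the projective half-space $\{\mathbf x:\mathbf h\cdot\mathbf x\ge0\}$, with interior $\{\mathbf x:\mathbf h\cdot\mathbf x>0\}$. For a finite set $V$ of points of $\mathbb{T}_p$ all lying in the interior of some projective half-space, the convex hull is the set of points whose coordinates are nonnegative, not-all-zero linear combinations of coordinate vectors of the points of $V$; such a convex hull is called a projective polytope. If $V$ is minimal (no point can be removed from $V$ without changing the convex hull), the points of $V$ are called the vertices of the projective polytope. $T^\leq$ is the projective polytope in $\mathbb{T}_p$ formed as the convex hull of: (i) the visible points $(v_1,\ldots,v_p,1)$ for every vertex $(v_1,\ldots,v_p)$ of $Y^\leq$; and (ii) the $p$ points at infinity $(-1,0,\ldots,0,0),(0,-1,\ldots,0,0),\ldots,(0,0,\ldots,-1,0)$. (All these points lie in the interior of a common projective half-space.) *)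

(* Defs.v *)
From mathcomp Require Import all_boot all_order all_algebra.
From mathcomp Require Import generic_quotient.
From mathcomp Require Import all_classical all_reals.
From mathcomp Require Import topology normedtype.

Set Implicit Arguments.
Unset Strict Implicit.
Unset Printing Implicit Defensive.

Import Order.TTheory GRing.Theory Num.Theory.
Import numFieldNormedType.Exports.

Local Open Scope classical_set_scope.
Local Open Scope quotient_scope.
Local Open Scope ring_scope.

(** * Euclidean notions; points of E_d are column vectors *)

(* MathComp has no order on matrices, hence the name. *)
Definition vle (R : realType) d (x y : 'cV[R]_d) := forall i, x i 0 <= y i 0.

(* The vertices of a polyhedron: its extreme points, i.e. the points that are
   not strictly between two distinct points of the polyhedron. *)
Definition vertices (R : realType) d (S : set 'cV[R]_d) : set 'cV[R]_d :=
  [set x | S x /\ forall a b t, S a -> S b -> 0 < t < 1 ->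
     x = t *: a + (1 - t) *: b -> a = b].

(** * The multiobjective linear program *)

Definition feasible (R : realType) m n (A : 'M[R]_(m, n)) (b : 'cV[R]_m) :
    set 'cV[R]_n :=
  [set x | A *m x = b /\ vle 0 x].

Definition outcomes (R : realType) m n p (A : 'M[R]_(m, n)) (b : 'cV[R]_m)
    (C : 'M[R]_(p, n)) : set 'cV[R]_p :=
  (fun x => C *m x) @` feasible A b.

Definition efficient (R : realType) p (Y : set 'cV[R]_p) : set 'cV[R]_p :=
  [set y | Y y /\ ~ exists y', [/\ Y y', y' <> y & vle y y']].

Definition efficient_extreme (R : realType) p (Y : set 'cV[R]_p) :
    set 'cV[R]_p :=
  vertices Y `&` efficient Y.

Definition down_closure (R : realType) p (Y : set 'cV[R]_p) : set 'cV[R]_p :=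
  [set z | exists2 y, Y y & vle z y].

(** * Oriented projective space *)

Definition hcoord (R : realType) p := {v : 'cV[R]_(p + 1) | v != 0}.

Definition hcoord_of (R : realType) p (v : 'cV[R]_(p + 1)) (v0 : v != 0) :
    hcoord R p :=
  exist _ v v0.

Definition same_ray (R : realType) p (u v : hcoord R p) : bool :=
  `[< exists2 k : R, 0 < k & val u = k *: val v >].

Lemma same_ray_refl (R : realType) p : reflexive (@same_ray R p).
Proof. by move=> u; apply/asboolP; exists 1; rewrite ?scale1r. Qed.

Lemma same_ray_sym (R : realType) p : symmetric (@same_ray R p).
Proof.
suff H (u v : hcoord R p) : same_ray u v -> same_ray v u.
  by move=> u v; apply/idP/idP; apply: H.
move=> /asboolP[k k0 uv]; apply/asboolP; exists k^-1; first by rewrite invr_gt0.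
by rewrite uv scalerA mulVf ?scale1r// gt_eqF.
Qed.

Lemma same_ray_trans (R : realType) p : transitive (@same_ray R p).
Proof.
move=> v u w /asboolP[k k0 uv] /asboolP[l l0 vw]; apply/asboolP.
by exists (k * l); rewrite ?mulr_gt0// uv vw scalerA.
Qed.

Canonical same_ray_equiv (R : realType) p :=
  EquivRel (@same_ray R p) (@same_ray_refl R p) (@same_ray_sym R p)
    (@same_ray_trans R p).

Definition oproj (R : realType) p := {eq_quot (same_ray_equiv R p)}.

(* The signed homogeneous coordinates of a chosen representative.  They are only
   defined up to a positive factor, to which all the notions below are
   insensitive. *)
Definition hrep (R : realType) p (x : oproj R p) : 'cV[R]_(p + 1) :=
  val (repr x).

Definition last_coord (R : realType) p (x : oproj R p) : R :=
  hrep x (rshift p ord0) 0.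

Definition visible (R : realType) p : set (oproj R p) :=
  [set x | 0 < last_coord x].

(* The Euclidean point identified with a visible point. *)
Definition euclid (R : realType) p (x : oproj R p) : 'cV[R]_p :=
  (last_coord x)^-1 *: usubmx (hrep x).

Lemma embed_subproof (R : realType) p (y : 'cV[R]_p) :
  col_mx y (1%:M : 'M[R]_1) != 0.
Proof. by rewrite col_mx_eq0 oner_eq0 andbF. Qed.

Lemma neg_axis_subproof (R : realType) p (i : 'I_p) :
  col_mx (- delta_mx i 0 : 'cV[R]_p) (0 : 'M[R]_1) != 0.
Proof.
rewrite col_mx_eq0 oppr_eq0 eqxx andbT; apply/eqP => /matrixP/(_ i 0).
by rewrite !mxE !eqxx; apply/eqP; rewrite oner_eq0.
Qed.

Definition embed (R : realType) p (y : 'cV[R]_p) : oproj R p :=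
  \pi_(oproj R p) (hcoord_of (embed_subproof y)).

Definition neg_axis (R : realType) p (i : 'I_p) : oproj R p :=
  \pi_(oproj R p) (hcoord_of (neg_axis_subproof R i)).

(* The interior of the projective half-space defined by h. *)
Definition halfspace_interior (R : realType) p (h : 'cV[R]_(p + 1)) :
    set (oproj R p) :=
  [set x | 0 < (h^T *m hrep x) 0 0].

(* Only meant for V finite and lying in the interior of some half-space. *)
Definition phull (R : realType) p (V : set (oproj R p)) : set (oproj R p) :=
  [set x | exists a : oproj R p -> R,
     [/\ forall v, V v -> 0 <= a v,
         exists2 v, V v & a v != 0 &
         hrep x = \sum_(v \in V) a v *: hrep v]].

Definition generates (R : realType) p (V P : set (oproj R p)) :=
  [/\ finite_set V,
      exists2 h, h != 0 & V `<=` halfspace_interior h &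
      phull V = P].

Definition pvertices (R : realType) p (P : set (oproj R p)) :
    set (oproj R p) :=
  [set x | exists V,
     [/\ generates V P, forall v, V v -> phull (V `\ v) <> P & V x]].

(** * The projective polytope associated with the downward closure *)

Definition Tle (R : realType) p (Y : set 'cV[R]_p) : set (oproj R p) :=
  phull (@embed R p @` vertices (down_closure Y) `|` range (@neg_axis R p)).

(* Main.v *)
(* A vertex of a downward closed set [D] cannot lie below another point of [D],
   which identifies the vertices of the downward closure of a convex set [Y] with
   the efficient vertices of [Y].  For the outcomes of a linear program they are
   finitely many, since a vertex [C x] is determined by the support of [x].  In
   the pointed cone over an oriented projective polytope, minimal generators span
   extreme rays, hence a minimal generating set is unique; it remains to see that
   the generators of [Tle Y] are minimal. *)
Require Import Defs.
From mathcomp Require Import all_boot all_order all_algebra.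
From mathcomp Require Import generic_quotient.
From mathcomp Require Import all_classical all_reals.
From mathcomp Require Import topology normedtype.
From mathcomp Require Import ring lra.

Set Implicit Arguments.
Unset Strict Implicit.
Unset Printing Implicit Defensive.

Import Order.TTheory GRing.Theory Num.Theory.
Import numFieldNormedType.Exports.
Local Open Scope classical_set_scope.
Local Open Scope ring_scope.

(** * Vertices of convex and downward closed sets *)

Definition convex_set (R : realType) d (S : set 'cV[R]_d) :=
  forall x y t, S x -> S y -> 0 < t < 1 -> S (t *: x + (1 - t) *: y).

Definition down_closed (R : realType) d (S : set 'cV[R]_d) :=
  forall x y, S y -> vle x y -> S x.

Lemma vle_trans (R : realType) d (x y z : 'cV[R]_d) :
  vle x y -> vle y z -> vle x z.
Proof. by move=> xy yz i; apply: le_trans (xy i) (yz i). Qed.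

Lemma vle_conv (R : realType) d (a b a' b' : 'cV[R]_d) (t : R) :
  0 < t < 1 -> vle a a' -> vle b b' ->
  vle (t *: a + (1 - t) *: b) (t *: a' + (1 - t) *: b').
Proof.
move=> /andP[t0 t1] aa bb i; rewrite !mxE lerD// ler_wpM2l//; first exact: ltW.
by rewrite subr_ge0 ltW.
Qed.

Lemma vertex_conv_eq (R : realType) d (S : set 'cV[R]_d) x a b t :
  vertices S x -> S a -> S b -> 0 < t < 1 -> x = t *: a + (1 - t) *: b -> x = a.
Proof.
move=> [_ xS] Sa Sb t01 xab; have ab := xS _ _ _ Sa Sb t01 xab.
by rewrite xab -ab -scalerDl addrC subrK scale1r.
Qed.

Lemma down_closure_closed (R : realType) d (S : set 'cV[R]_d) :
  down_closed (down_closure S).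
Proof. by move=> x y [z Sz yz] xy; exists z => //; apply: vle_trans yz. Qed.

Lemma down_closure_convex (R : realType) d (S : set 'cV[R]_d) :
  convex_set S -> convex_set (down_closure S).
Proof.
move=> cS x y t [x' Sx xx] [y' Sy yy] t01.
by exists (t *: x' + (1 - t) *: y'); [exact: cS|exact: vle_conv].
Qed.

(** [x] is the midpoint of [y] and its reflection [2%:R *: x - y], which lies below [y] because [x]
    does. *)
Lemma vertex_down_closure_max (R : realType) d (S : set 'cV[R]_d) x y :
  vertices (down_closure S) x -> S y -> vle x y -> x = y.
Proof.
move=> vx Sy xy.
apply: (@vertex_conv_eq _ _ _ _ _ (2%:R *: x - y) 2^-1 vx).
- by exists y.
- by exists y => // i; have := xy i; rewrite !mxE; lra.
- lra.
- by apply/colP => i; rewrite !mxE; field.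
Qed.

Lemma vertices_down_closure (R : realType) d (S : set 'cV[R]_d) :
  convex_set S -> vertices (down_closure S) = efficient_extreme S.
Proof.
move=> cS; apply/seteqP; split=> x.
  move=> vx; have [[y Sy xy] _] := vx.
  have {y Sy xy}Sx : S x by rewrite (vertex_down_closure_max vx Sy xy).
  split; split=> //.
    move=> a b t Sa Sb; case: vx => _; apply; by [exists a|exists b].
  by move=> [y [Sy yx xy]]; apply/yx/esym/(vertex_down_closure_max vx).
(* The endpoints [a] and [b] are raised to dominating points of [S]; efficiency makes the raised
   combination equal to [x], and extremality then gives [a' = b' = x]. *)
move=> [vx [Sx effx]]; split; first by exists x.
move=> a b t [a' Sa aa] [b' Sb bb] t01 xab.
have x_le : vle x (t *: a' + (1 - t) *: b') by rewrite xab; apply: vle_conv.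
have xab' : x = t *: a' + (1 - t) *: b'.
  apply: contrapT => ne; apply: effx; eexists; split; last exact: x_le.
    exact: cS.
  exact/nesym.
have xa' : x = a' := vertex_conv_eq vx Sa Sb t01 xab'.
have a'b' : a' = b' by case: vx => _; apply; [exact: Sa|exact: Sb|exact: t01|].
apply/colP => i; have := aa i; have := bb i; rewrite -a'b' -xa'.
have /andP[t0 t1] := t01.
have /colP/(_ i) := xab; rewrite !mxE => xi bi ai.
(* [x] dominates [a] and [b] and is their weighted mean, so both nonnegative weighted gaps
   vanish. *)
have ta : t * (x i 0 - a i 0) >= 0 by rewrite mulr_ge0 ?subr_ge0// ltW.
have tb : (1 - t) * (x i 0 - b i 0) >= 0 by rewrite mulr_ge0 ?subr_ge0// ltW.
have /eqP : t * (x i 0 - a i 0) = 0 by lra.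
have /eqP : (1 - t) * (x i 0 - b i 0) = 0 by lra.
rewrite !mulf_eq0 !subr_eq0 (gt_eqF t0) [1 == t]gt_eqF//=.
by move=> /eqP <- /eqP <-.
Qed.

(** * Outcome sets *)

Lemma outcomes_convex (R : realType) m n p (A : 'M[R]_(m, n)) b
  (C : 'M[R]_(p, n)) : convex_set (outcomes A b C).
Proof.
move=> _ _ t [x [Ax x0] <-] [y [Ay y0] <-] /andP[t0 t1].
exists (t *: x + (1 - t) *: y); last by rewrite mulmxDr -!scalemxAr.
split; first by rewrite mulmxDr -!scalemxAr Ax Ay -scalerDl addrC subrK scale1r.
move=> i; have := x0 i; have := y0 i; rewrite !mxE => yi xi.
by rewrite addr_ge0// mulr_ge0// ?subr_ge0// ltW.
Qed.

(** Moving from [x] directly away from [x'] stays feasible for a short while, since only positive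
    coordinates of [x] can decrease. Hence [C *m x] is a proper convex combination of [C *m x'] and
    another outcome. *)
Lemma vertex_outcome_support (R : realType) m n p (A : 'M[R]_(m, n)) b
    (C : 'M[R]_(p, n)) x x' :
  feasible A b x -> feasible A b x' -> vertices (outcomes A b C) (C *m x) ->
  (forall i, x i 0 = 0 -> x' i 0 = 0) -> C *m x = C *m x'.
Proof.
move=> fx fx' vx supp; have [Ax x0] := fx; have [Ax' x'0] := fx'.
have r0 i : 0 <= x' i 0 / x i 0.
  by have := x0 i; have := x'0 i; rewrite !mxE => *; rewrite divr_ge0.
(* [s] bounds every ratio [x' i 0 / x i 0]; where [x i 0 = 0] the quotient is 0 by convention. The
   summand 1 makes [s] positive. *)
pose s := 1 + \sum_i x' i 0 / x i 0.
have s1 : 1 <= s by rewrite lerDl sumr_ge0.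
have s0 : 0 < s by apply: lt_le_trans s1.
have s'0 : 1 + s != 0 by rewrite gt_eqF// addr_gt0.
(* [w] lies beyond [x] on the ray from [x'] through [x]. *)
pose w := x + s^-1 *: (x - x').
have fw : feasible A b w.
  split; first by rewrite mulmxDr -scalemxAr mulmxBr Ax Ax' subrr scaler0 addr0.
  move=> i; have := x0 i; have := x'0 i; rewrite !mxE => x'i xi.
  have [x_eq0|x_neq0] := eqVneq (x i 0) 0.
    by rewrite x_eq0 supp// subrr mulr0 addr0.
  have : x' i 0 <= s * x i 0.
    rewrite -ler_pdivrMr ?lt_def ?x_neq0//.
    rewrite /s (bigD1 i)//= addrCA lerDl addr_ge0// sumr_ge0// => j _; exact: r0.
  move=> le; rewrite -(pmulr_rge0 _ s0) mulrDr mulrA divff ?gt_eqF// mul1r.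
  by lra.
apply: (@vertex_conv_eq _ _ _ _ _ (C *m w) (1 + s)^-1 vx).
- by exists x'.
- by exists w.
- have s1' : 1 < 1 + s by rewrite ltrDl.
  have s'_gt0 : 0 < 1 + s := lt_trans ltr01 s1'.
  by apply/andP; split; [rewrite invr_gt0|rewrite invf_lt1].
- rewrite !scalemxAr -mulmxDr; congr (_ *m _).
  by apply/colP => i; rewrite !mxE; field; rewrite s'0 gt_eqF.
Qed.

Lemma finite_vertices_outcomes (R : realType) m n p (A : 'M[R]_(m, n)) b
  (C : 'M[R]_(p, n)) : finite_set (vertices (outcomes A b C)).
Proof.
(* [Q s] has at most one element by [vertex_outcome_support], so choosing one per zero set [s]
   reaches every vertex; the default 0 of [xget] only enlarges the image. *)
pose Q (s : {set 'I_n}) := [set y | vertices (outcomes A b C) y /\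
  exists2 x, feasible A b x /\ C *m x = y & s = [set i | x i 0 == 0]%SET].
apply: (@sub_finite_set _ _ ((fun s => xget 0 (Q s)) @` [set: {set 'I_n}])).
  move=> y vy; have [[x fx xy] _] := vy.
  exists [set i | x i 0 == 0]%SET => //; case: xgetP => [z _|/(_ y) []]; last first.
    by split=> //; exists x.
  move=> [vz [x' [fx' <-] e]]; rewrite -xy; apply/esym.
  apply: (vertex_outcome_support fx fx'); first by rewrite xy.
  by move=> i /eqP xi; move/setP/(_ i): e; rewrite !inE xi => /esym/eqP.
exact/finite_image/finite_finset.
Qed.

(** * Cones over sets of oriented projective points *)

Lemma hrep_neq0 (R : realType) p (x : oproj R p) : hrep x != 0.
Proof. exact: (valP (repr x)). Qed.

Lemma hrep_inj_scale (R : realType) p (x y : oproj R p) k :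
  0 < k -> hrep x = k *: hrep y -> x = y.
Proof.
move=> k0 xy; rewrite -[x]reprK -[y]reprK; apply/eqmodP/asboolP.
by exists k.
Qed.

Lemma hrep_pi (R : realType) p (u : hcoord R p) :
  exists2 k, 0 < k & hrep (\pi_(oproj R p)%qT u) = k *: val u.
Proof.
have /eqmodP/asboolP[k k0 e] : (repr (\pi_(oproj R p)%qT u) = u
   %[mod oproj R p])%qT by rewrite reprK.
by exists k.
Qed.

Lemma hrep_embed (R : realType) p (y : 'cV[R]_p) :
  exists2 k, 0 < k & hrep (embed y) = k *: col_mx y 1%:M.
Proof. exact: hrep_pi. Qed.

Lemma hrep_neg_axis (R : realType) p (i : 'I_p) :
  exists2 k, 0 < k & hrep (neg_axis R i) = k *: col_mx (- delta_mx i 0) 0.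
Proof. exact: hrep_pi. Qed.

(** The inductive form, with positive coefficients, gives induction over the terms of a combination
    and access to a leading one. Unlike [phull], it admits the origin. *)
Inductive pcone (R : realType) p (V : set (oproj R p)) :
    'cV[R]_(p + 1) -> Prop :=
| pcone0 : pcone V 0
| pcone_cons v a u : V v -> 0 < a -> pcone V u -> pcone V (a *: hrep v + u).

Lemma pcone_hrep (R : realType) p (V : set (oproj R p)) v a :
  V v -> 0 <= a -> pcone V (a *: hrep v).
Proof.
rewrite le_eqVlt => Vv /predU1P[<-|a0]; first by rewrite scale0r; exact: pcone0.
by rewrite -[_ *: _]addr0; apply: pcone_cons => //; exact: pcone0.
Qed.

Lemma pconeD (R : realType) p (V : set (oproj R p)) u w :
  pcone V u -> pcone V w -> pcone V (u + w).
Proof.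
move=> Vu Vw; elim: Vu => [|v a u' Vv a0 _ IH]; first by rewrite add0r.
by rewrite -addrA; apply: pcone_cons.
Qed.

Lemma pconeZ (R : realType) p (V : set (oproj R p)) u a :
  0 <= a -> pcone V u -> pcone V (a *: u).
Proof.
move=> a0; elim=> [|v c u' Vv c0 _ IH]; first by rewrite scaler0; exact: pcone0.
rewrite scalerDr scalerA; apply: pconeD => //; apply: pcone_hrep => //.
by rewrite mulr_ge0// ltW.
Qed.

Lemma pcone_subset (R : realType) p (V W : set (oproj R p)) :
  (forall v, V v -> pcone W (hrep v)) -> pcone V `<=` pcone W.
Proof.
move=> VW u; elim=> [|v a u' Vv a0 _ IH]; first exact: pcone0.
by apply: pconeD => //; apply: pconeZ; [exact: ltW|exact: VW].
Qed.

Lemma pcone_split (R : realType) p (V : set (oproj R p)) v u :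
  pcone V u ->
  exists c u', [/\ 0 <= c, pcone (V `\ v) u' & u = c *: hrep v + u'].
Proof.
elim=> [|w a u0 Vw a0 _ [c [u' [c0 Vu ->]]]].
  by exists 0, 0; rewrite scale0r addr0; split=> //; exact: pcone0.
have [->|wv] := pselect (w = v).
  exists (a + c), u'; split=> //; last by rewrite addrA -scalerDl.
  by rewrite addr_ge0// ltW.
by exists c, (a *: hrep w + u'); split=> //; [exact: pcone_cons|exact: addrCA].
Qed.

Lemma scale_colE (R : realType) n a (v : 'cV[R]_n) i : (a *: v) i 0 = a * v i 0.
Proof. exact: mxE. Qed.

Lemma scale_addE (R : realType) n a (v u : 'cV[R]_n) i :
  (a *: v + u) i 0 = a * v i 0 + u i 0.
Proof. by rewrite !mxE. Qed.

Lemma usubmx_scale_add (R : realType) m n a (v : 'cV[R]_m) (w : 'cV[R]_n) u :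
  usubmx (a *: col_mx v w + u) = a *: v + usubmx u.
Proof. by rewrite linearD/= linearZ/= col_mxKu. Qed.

Lemma mulmx_scale_addE (R : realType) m n (A : 'M[R]_(m, n)) a
    (v u : 'cV[R]_n) i :
  (A *m (a *: v + u)) i 0 = a * (A *m v) i 0 + (A *m u) i 0.
Proof. by rewrite mulmxDr -scalemxAr scale_addE. Qed.

Lemma pcone_dot_ge0 (R : realType) p (V : set (oproj R p)) h u :
  V `<=` halfspace_interior h -> pcone V u -> 0 <= (h^T *m u) 0 0.
Proof.
move=> Vh; elim=> [|v a u' /Vh hv a0 _ IH]; first by rewrite mulmx0 mxE.
by rewrite mulmx_scale_addE addr_ge0// mulr_ge0// ltW.
Qed.

(** This is pointedness of the cone: a leading term would pair strictly positively with [h], and the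
    rest nonnegatively. *)
Lemma pcone_dot_eq0 (R : realType) p (V : set (oproj R p)) h u :
  V `<=` halfspace_interior h -> pcone V u -> (h^T *m u) 0 0 <= 0 -> u = 0.
Proof.
move=> Vh [//|v a u' Vv a0 /(pcone_dot_ge0 Vh)]; have := Vh _ Vv.
rewrite /halfspace_interior/= mulmx_scale_addE => hv hu' le0; exfalso.
by have := mulr_gt0 a0 hv; lra.
Qed.

Lemma phullP (R : realType) p (V : set (oproj R p)) x :
  finite_set V -> phull V x <-> pcone V (hrep x).
Proof.
move=> finV; split.
  move=> [a [a0 _ ->]]; rewrite fsbig_finite//= big_seq.
  apply: (big_ind (pcone V)); first exact: pcone0.
    exact: pconeD.
  by move=> v; rewrite in_fset_set// inE => Vv; apply: pcone_hrep; [|exact: a0].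
move=> Vx.
(* A nonzero coefficient then comes for free, as [hrep x] is not zero. *)
suff [a [a0 xa]] : exists a : oproj R p -> R, (forall v, V v -> 0 <= a v) /\
    hrep x = \sum_(v \in V) a v *: hrep v.
  exists a; split=> //; apply: contrapT => ne.
  have /eqP := hrep_neq0 x; apply; rewrite xa fsbig1// => v Vv.
  have [->|av] := eqVneq (a v) 0; first by rewrite scale0r.
  by case: ne; exists v.
elim: Vx => [|v c u Vv c0 _ [a [a0 ->]]].
  by exists (fun=> 0); split=> //; rewrite fsbig1// => v _; rewrite scale0r.
exists (fun w => (w == v)%:R * c + a w); split=> [w Vw|].
  by rewrite addr_ge0 ?a0// mulr_ge0// ltW.
under [RHS]eq_fsbigr do rewrite scalerDl.
rewrite fsbig_split//; congr (_ + _).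
rewrite (fsbigD1 v)//=.
rewrite eqxx mul1r fsbig1 ?addr0// => w [_ /eqP/negbTE ->].
by rewrite mul0r scale0r.
Qed.

Lemma phull_sub (R : realType) p (V : set (oproj R p)) :
  finite_set V -> V `<=` phull V.
Proof.
move=> finV v Vv; apply/phullP => //; rewrite -[hrep v]scale1r.
exact: pcone_hrep.
Qed.

Lemma phull_setD1 (R : realType) p (V : set (oproj R p)) v :
  finite_set V -> V v -> pcone (V `\ v) (hrep v) -> phull (V `\ v) = phull V.
Proof.
move=> finV Vv Vv'; have finV' : finite_set (V `\ v) by exact: finite_setD.
apply/seteqP; split=> x /phullP Vx; apply/phullP => //.
  move/(_ finV'): Vx; apply: pcone_subset => w [Vw _].
  by apply/phullP => //; exact: phull_sub.
move/(_ finV): Vx; apply: pcone_subset => w Vw.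
have [->//|wv] := pselect (w = v).
by apply/phullP => //; exact: phull_sub.
Qed.

(* A minimal generator [v] is a positive combination of elements of [W]; since
   the ray of [v] is extreme in the pointed cone over [V], all the terms of the
   combination lie on it. *)
Lemma minimal_generators_sub (R : realType) p (P V W : set (oproj R p)) :
  generates V P -> (forall v, V v -> phull (V `\ v) <> P) ->
  finite_set W -> phull W = P -> V `<=` W.
Proof.
move=> [finV [h _ Vh] VP] minV finW WP v Vv.
have WV : pcone W `<=` pcone V.
  apply: pcone_subset => w Ww; apply/phullP => //.
  by rewrite VP -WP; exact: phull_sub.
have : pcone W (hrep v).
  by apply/phullP => //; rewrite WP -VP; exact: phull_sub.
move e : (hrep v) => u Wu; case: Wu e => [v0|w a r Ww a0 /WV Vr e].
  by have := hrep_neq0 v; rewrite v0 eqxx.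
have Vw : pcone V (hrep w).
  by apply: WV; apply/phullP => //; exact: phull_sub.
have [c [w' [c0 Vw' we]]] := pcone_split v Vw.
have [d [r' [d0 Vr' re]]] := pcone_split v Vr.
have VDh : V `\ v `<=` halfspace_interior h by move=> x [/Vh].
(* The coefficient left to [hrep v] once its multiples inside [a *: hrep w] and [r] are moved to the
   left. *)
pose q := 1 - a * c - d.
have qe : q *: hrep v = a *: w' + r'.
  move: e; rewrite re we => /colP e; apply/colP => i.
  have := e i; rewrite !mxE => ei; rewrite /q !mulrBl mul1r {1}ei; ring.
(* If [q] is positive, [v] lies in the cone of the other generators, against minimality. *)
have [q0|q0] := ltP 0 q.
  case: (minV v Vv); rewrite -VP; apply: phull_setD1 => //.
  rewrite -[hrep v]scale1r -(mulVf (lt0r_neq0 q0)) -scalerA qe.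
  apply: pconeZ; first by rewrite invr_ge0 ltW.
  by apply: pconeD => //; apply: pconeZ => //; exact: ltW.
(* Now [a *: w' + r'] pairs nonpositively with [h], although both terms pair nonnegatively; so [w']
   vanishes and [w] lies on the ray of [v]. *)
have w'0 : w' = 0.
  apply: (pcone_dot_eq0 VDh Vw').
  have hv : 0 < (h^T *m hrep v) 0 0 by exact: Vh.
  have := mulr_le0_ge0 q0 (ltW hv).
  have -> : q * (h^T *m hrep v) 0 0 = a * (h^T *m w') 0 0 + (h^T *m r') 0 0.
    have := congr1 (fun z => (h^T *m z) 0 0) qe.
    rewrite /= mulmx_scale_addE => <-.
    by rewrite -scalemxAr [RHS]mxE.
  have := pcone_dot_ge0 VDh Vr' => hr le0.
  by rewrite -(pmulr_rle0 _ a0); lra.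
rewrite w'0 addr0 in we.
suff <- : w = v by [].
apply: (hrep_inj_scale _ we); rewrite lt_def c0 andbT.
by apply: contraTneq (hrep_neq0 w) => c00; rewrite we c00 scale0r eqxx.
Qed.

Lemma pvertices_minimal (R : realType) p (P V : set (oproj R p)) :
  generates V P -> (forall v, V v -> phull (V `\ v) <> P) -> pvertices P = V.
Proof.
move=> gV minV; have [finV _ VP] := gV; apply/seteqP; split=> [x|x Vx].
  by move=> [W [gW minW Wx]]; exact: (minimal_generators_sub gW minW finV VP).
by exists V.
Qed.

(** * The projective polytope *)

(** [Tle Y] is by definition the hull of these points for [D := down_closure Y]. *)
Definition polytope_gens (R : realType) p (D : set 'cV[R]_p) :
    set (oproj R p) :=
  @embed R p @` vertices D `|` range (@neg_axis R p).

Lemma last_coord_embed (R : realType) p (y : 'cV[R]_p) :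
  0 < last_coord (embed y).
Proof.
rewrite /last_coord; have [k k0 ->] := hrep_embed y.
by rewrite mxE col_mxEd mxE eqxx mulr1.
Qed.

Lemma last_coord_neg_axis (R : realType) p (i : 'I_p) :
  last_coord (neg_axis R i) = 0.
Proof.
rewrite /last_coord; have [k k0 ->] := hrep_neg_axis R i.
by rewrite mxE col_mxEd mxE mulr0.
Qed.

Lemma embed_neq_neg_axis (R : realType) p (y : 'cV[R]_p) i :
  embed y <> neg_axis R i.
Proof.
by move=> e; have := last_coord_embed y; rewrite e last_coord_neg_axis ltxx.
Qed.

Lemma embedK (R : realType) p : cancel (@embed R p) (@euclid R p).
Proof.
move=> y; rewrite /euclid /last_coord; have [k k0 ->] := hrep_embed y.
rewrite mxE col_mxEd mxE eqxx mulr1 linearZ/= col_mxKu.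
by rewrite scalerA mulVf ?scale1r// gt_eqF.
Qed.

Lemma polytope_gens_halfspace (R : realType) p (D : set 'cV[R]_p) :
  finite_set (vertices D) ->
  exists2 h, h != 0 & polytope_gens D `<=` halfspace_interior h.
Proof.
move=> finD.
pose M : R := 1 + \sum_(v \in vertices D) `|\sum_i v i 0|.
have M0 : 0 < M by rewrite ltr_pwDl// fsumr_ge0.
(* Up to positive factors, this vector pairs to 1 with each axis point and to [M] minus the
   coordinate sum of [v] with [embed v]; [M] exceeds all these sums. *)
exists (col_mx (const_mx (-1)) M%:M).
  apply/eqP => /colP/(_ (rshift p ord0)); rewrite col_mxEd !mxE eqxx mulr1n.
  by apply/eqP; rewrite gt_eqF.
move=> _ [[v Dv <-]|[i _ <-]]; rewrite /halfspace_interior/=.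
  have [k k0 ->] := hrep_embed v.
  rewrite -scalemxAr tr_col_mx mul_row_col mxE mulr_gt0// !mxE big_ord1 !mxE.
  rewrite eqxx mulr1 mulr1n.
  under eq_bigr do rewrite !mxE mulN1r.
  rewrite sumrN addrC subr_gt0 /M (fsbigD1 v)//=.
  rewrite addrCA; apply: le_lt_trans (ler_norm _) _.
  by rewrite ltrDl ltr_pwDl// fsumr_ge0.
have [k k0 ->] := hrep_neg_axis R i.
rewrite -scalemxAr tr_col_mx mul_row_col mulmx0 addr0 mxE mulr_gt0// mxE.
rewrite (bigD1 i)//= big1 => [|j ji].
  by rewrite !mxE !eqxx addr0 mulrNN mulr1.
by rewrite !mxE (negbTE ji) oppr0 mulr0.
Qed.

Lemma finite_polytope_gens (R : realType) p (D : set 'cV[R]_p) :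
  finite_set (vertices D) -> finite_set (polytope_gens D).
Proof.
by move=> finD; rewrite finite_setU; split; apply: finite_image.
Qed.

(** The other generators have nonnegative last coordinate, and those where it is 0 are the other
    axis points, whose coordinate [i] is 0; that of [neg_axis R i] is negative. *)
Lemma neg_axis_extreme (R : realType) p (D : set 'cV[R]_p) i :
  ~ pcone (polytope_gens D `\ neg_axis R i) (hrep (neg_axis R i)).
Proof.
suff H u : pcone (polytope_gens D `\ neg_axis R i) u ->
    0 <= u (rshift p ord0) 0 /\
    (u (rshift p ord0) 0 = 0 -> 0 <= u (lshift 1 i) 0).
  move=> /H[_]; have [k k0 ->] := hrep_neg_axis R i.
  rewrite !scale_colE col_mxEd col_mxEu !mxE !eqxx mulr0 => /(_ erefl).
  by rewrite mulrN1 oppr_ge0 leNgt k0.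
elim=> [|v a u' [[[y Dy <-]|[j _ <-]] ni] a0 _ [IH1 IH2]]; first by rewrite !mxE.
  have [k k0 ->] := hrep_embed y.
  rewrite !scale_addE !scale_colE col_mxEd mxE eqxx mulr1.
  by have := mulr_gt0 a0 k0; lra.
have ji : i != j by apply/eqP => ij; apply: ni; rewrite ij.
have [k k0 ->] := hrep_neg_axis R j.
rewrite !scale_addE !scale_colE col_mxEd col_mxEu !mxE (negbTE ji).
by rewrite oppr0 !mulr0 !add0r.
Qed.

(* The conclusion describes the cone over [D] together with its recession
   directions by the fact that adding them to points of the cone over [D]
   stays in that cone; this form is stable under addition. *)
Lemma pcone_polytope_gens (R : realType) p (D : set 'cV[R]_p) u :
  convex_set D -> down_closed D -> pcone (polytope_gens D) u ->
  0 <= u (rshift p ord0) 0 /\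
  forall y s, 0 < s -> D y ->
    D ((s + u (rshift p ord0) 0)^-1 *: (s *: y + usubmx u)).
Proof.
move=> cD dD; elim=> [|v a u' [[z [Dz _] <-]|[j _ <-]] a0 _ [IH1 IH2]].
- rewrite mxE; split=> // y s s0 Dy.
  by rewrite addr0 linear0 addr0 scalerA mulVf ?scale1r// gt_eqF.
- have [k k0 ->] := hrep_embed z.
  rewrite scalerA; have := mulr_gt0 a0 k0; move: (a * k) => c c0.
  rewrite scale_addE col_mxEd mxE eqxx mulr1; split; first by rewrite addr_ge0// ltW.
  move=> y s s0 Dy; have sc0 : 0 < s + c by rewrite addr_gt0.
  rewrite addrA usubmx_scale_add addrA.
  (* Adding [z] with weight [c] to [y] with weight [s] gives a point of [D] with weight [s + c], to
     which the induction hypothesis applies. *)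
  pose t := s / (s + c).
  have -> : s *: y + c *: z = (s + c) *: (t *: y + (1 - t) *: z).
    by apply/colP => i; rewrite !mxE /t; field; rewrite gt_eqF.
  apply: IH2 => //; apply: cD => //.
  by rewrite divr_gt0//= ltr_pdivrMr// mul1r ltrDl.
- have [k k0 ->] := hrep_neg_axis R j.
  rewrite scalerA; have := mulr_gt0 a0 k0; move: (a * k) => c c0.
  rewrite scale_addE col_mxEd mxE mulr0 add0r; split=> // y s s0 Dy.
  rewrite usubmx_scale_add addrA.
  (* An axis direction keeps the weight [s] and only lowers coordinate [j] of [y]. *)
  have -> : s *: y + c *: - delta_mx j 0 = s *: (y - (c / s) *: delta_mx j 0).
    by apply/colP => i; rewrite !mxE; field; rewrite gt_eqF.
  apply: IH2 => //; apply: dD Dy _ => i; rewrite !mxE gerBl.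
  by rewrite mulr_ge0// ltW// divr_gt0.
Qed.

(** Axis points have last coordinate 0, so a positive one needs a term from an embedded vertex; that
    term is brought to the front. *)
Lemma pcone_polytope_gens_visible (R : realType) p (D : set 'cV[R]_p) W u :
  W `<=` polytope_gens D -> pcone W u -> 0 < u (rshift p ord0) 0 ->
  exists y c u', [/\ W (embed y), vertices D y, 0 < c, pcone W u' &
                     u = c *: col_mx y 1%:M + u'].
Proof.
move=> WD; elim=> [|v a u' Wv a0 Wu IH]; first by rewrite mxE ltxx.
case: (WD v Wv) => [[y Dy yv]|[j _ jv]].
  move=> _; have [k k0 e] := hrep_embed y.
  by exists y, (a * k), u'; rewrite -yv e -scalerA mulr_gt0// yv.
have := last_coord_neg_axis R j; rewrite /last_coord jv => v0.
rewrite scale_addE v0 mulr0 add0r => /IH[y [c [r [Wy Dy c0 Wr ->]]]].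
exists y, c, (a *: hrep v + r); split=> //; last exact: addrCA.
exact: pcone_cons.
Qed.

(** Otherwise some vertex [z] other than [y] occurs in the combination, and [y] is a proper convex
    combination of [z] and a point of [D]. *)
Lemma embed_extreme (R : realType) p (D : set 'cV[R]_p) y :
  convex_set D -> down_closed D -> vertices D y ->
  ~ pcone (polytope_gens D `\ embed y) (hrep (embed y)).
Proof.
move=> cD dD vy; have WD : polytope_gens D `\ embed y `<=` polytope_gens D.
  by move=> x [].
have [k k0 e] := hrep_embed y.
move=> /(@pconeZ _ _ _ _ k^-1); rewrite invr_ge0 e => /(_ (ltW k0)).
rewrite scalerA mulVf ?gt_eqF// scale1r.
move=> /(pcone_polytope_gens_visible WD).
rewrite col_mxEd mxE eqxx => /(_ ltr01)[z [c [r [[_ zy] [Dz _] c0 Wr re]]]].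
have : pcone (polytope_gens D) r.
  apply: pcone_subset Wr => v [Vv _]; rewrite -[hrep v]scale1r.
  exact: pcone_hrep.
move=> /(pcone_polytope_gens cD dD)[r0 rD].
have rl : r (rshift p ord0) 0 = 1 - c.
  have /colP/(_ (rshift p ord0)) := re.
  by rewrite scale_addE !col_mxEd mxE eqxx mulr1n; lra.
have ru : usubmx r = y - c *: z.
  have := congr1 (@usubmx _ p 1 1) re.
  by rewrite usubmx_scale_add col_mxKu => ->; rewrite addrC addKr.
(* Only half of the weight [c] of [z] is split off: the remaining weight [1 - c / 2] is positive
   even when [1 - c] is 0, so the rest can be normalized to a point of [D]. *)
rewrite rl in r0 rD; have c20 : 0 < c / 2 by rewrite divr_gt0.
have {}rD := rD z (c / 2) c20 Dz.
apply: zy; congr embed; apply/esym.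
apply: (vertex_conv_eq (t := c / 2) vy Dz rD).
  by lra.
rewrite ru; apply/colP => i; rewrite !mxE; field.
by rewrite gt_eqF//; lra.
Qed.

Lemma pvertices_polytope (R : realType) p (D : set 'cV[R]_p) :
  convex_set D -> down_closed D -> finite_set (vertices D) ->
  pvertices (phull (polytope_gens D)) = polytope_gens D.
Proof.
move=> cD dD finD; have finG := finite_polytope_gens finD.
apply: pvertices_minimal.
  by split=> //; exact: polytope_gens_halfspace.
move=> v Gv e; have : phull (polytope_gens D) v by exact: phull_sub.
rewrite -e => /(phullP _ (finite_setD _ finG)).
case: Gv => [[y vy <-]|[i _ <-]]; first exact: embed_extreme.
exact: neg_axis_extreme.
Qed.

Theorem corollary4p8 (R : realType) (m n p : nat)
    (A : 'M[R]_(m, n)) (b : 'cV[R]_m) (C : 'M[R]_(p, n)) :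
  bounded_set (feasible A b) ->
  let Y := outcomes A b C in
  @euclid R p @` (pvertices (Tle Y) `&` @visible R p) = efficient_extreme Y /\
  pvertices (Tle Y) `\` @embed R p @` efficient_extreme Y =
    range (@neg_axis R p).
Proof.
move=> _ Y; have cY : convex_set Y := @outcomes_convex _ _ _ _ A b C.
have vD := vertices_down_closure cY.
(* Both claims follow from this description, the sign of the last coordinate telling the two kinds
   of vertices apart. *)
have -> : pvertices (Tle Y) =
    @embed R p @` efficient_extreme Y `|` range (@neg_axis R p).
  rewrite -vD; apply: pvertices_polytope.
  - exact: down_closure_convex.
  - exact: down_closure_closed.
  - rewrite vD; apply: sub_finite_set (finite_vertices_outcomes A b C).
    by move=> x [].
split; apply/seteqP; split.
- move=> _ [x [[[y Ey <-]|[i _ <-]]] + <-]; first by rewrite embedK.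
  by rewrite /visible/= last_coord_neg_axis ltxx.
- move=> y Ey; exists (embed y); last exact: embedK.
  by split; [left; exists y|exact: last_coord_embed].
- by move=> x [[|]].
- move=> _ [i _ <-]; split; first by right; exists i.
  by move=> [y _ /embed_neq_neg_axis].
Qed.
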